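(* There is an existential formula $\varphi(x)$ without parameters in the language $\mathcal{L}_{\rm ring}\cup\{P_2\}$ such that $\mathcal{O}_K=\varphi(K)$ holds for every Henselian valued field $K$ whose residue field is finite or pseudo-finite of characteristic not equal to $2$.
   Context: $\mathcal{L}_{\rm ring}=(+,-,\cdot,0,1)$ is the language of rings. $P_2$ is a unary predicate interpreted in a field as the set of nonzero squares. A Henselian valued field $K$ has a nontrivial Henselian valuation with valuation ring $\mathcal{O}_K$. A pseudo-finite field is an infinite perfect pseudo-algebraically closed field with exactly one extension of each finite degree. An existential formula is one of the form $\exists y_1\dots\exists y_n\,\psi$ with $\psi$ quantifier-free (possibly containing negated atomic formulas, including negated predicates). $\varphi(K)$ denotes the set of elements of $K$ satisfying $\varphi$. *)

(* Defs.v *)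
From HB Require Import structures.
From mathcomp Require Import all_boot all_order all_algebra.
From mathcomp Require Import ring_quotient separable mpoly.

Set Implicit Arguments.
Unset Strict Implicit.
Unset Printing Implicit Defensive.

Import Order.TTheory GRing.Theory Num.Theory.
Local Open Scope ring_scope.
Local Open Scope quotient_scope.

(** * First-order formulas in the language of rings expanded by P_2 *)

(* [term n] and [formula n] have their free variables among ['I_n]. *)
Inductive term (n : nat) : Type :=
| TVar of 'I_n
| TZero
| TOne
| TOpp of term n
| TAdd of term n & term n
| TMul of term n & term n.

Inductive formula : nat -> Type :=
| FEq n of term n & term n : formula n
| FP2 n of term n : formula n
| FNot n of formula n : formula n
| FAnd n of formula n & formula n : formula n
| FOr n of formula n & formula n : formula n
| FEx n of formula n.+1 : formula n
| FAll n of formula n.+1 : formula n.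

Fixpoint quantifier_free n (f : formula n) : bool :=
  match f with
  | FEq _ _ _ | FP2 _ _ => true
  | FNot _ g => quantifier_free g
  | FAnd _ g h | FOr _ g h => quantifier_free g && quantifier_free h
  | FEx _ _ | FAll _ _ => false
  end.

Fixpoint existential n (f : formula n) : bool :=
  match f with
  | FEx _ g => existential g
  | g => quantifier_free g
  end.

Section Semantics.
Variable K : fieldType.

Fixpoint eval n (e : 'I_n -> K) (t : term n) : K :=
  match t with
  | TVar i => e i
  | TZero => 0
  | TOne => 1
  | TOpp s => - eval e s
  | TAdd s u => eval e s + eval e u
  | TMul s u => eval e s * eval e u
  end.

Definition nonzero_square (x : K) : Prop := exists2 y : K, y != 0 & x = y ^+ 2.

(* A quantifier binds the variable [ord0]; the others are shifted by [lift]. *)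
Definition env_cons n (a : K) (e : 'I_n -> K) : 'I_n.+1 -> K :=
  fun i => if unlift ord0 i is Some j then e j else a.

Fixpoint holds n (f : formula n) : ('I_n -> K) -> Prop :=
  match f in formula m return ('I_m -> K) -> Prop with
  | FEq _ s t => fun e => eval e s = eval e t
  | FP2 _ t => fun e => nonzero_square (eval e t)
  | FNot _ g => fun e => ~ holds g e
  | FAnd _ g h => fun e => holds g e /\ holds h e
  | FOr _ g h => fun e => holds g e \/ holds h e
  | FEx _ g => fun e => exists a : K, holds g (env_cons a e)
  | FAll _ g => fun e => forall a : K, holds g (env_cons a e)
  end.

Definition satisfies (phi : formula 1) (x : K) : Prop :=
  holds phi (fun=> x).

End Semantics.

(** * Valued fields *)

HB.mixin Record POrderedZmodule_isOrderedGroup G of Num.POrderedZmodule G := {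
  og_total : total (<=%R : rel G);
  og_leD2r : forall z x y : G, x <= y -> x + z <= y + z
}.

#[short(type="orderedGroupType")]
HB.structure Definition OrderedGroup :=
  { G of POrderedZmodule_isOrderedGroup G & Num.POrderedZmodule G }.

(* The value at 0, which should be +oo, is left unspecified and never used. *)
Record valuation (K : fieldType) (G : orderedGroupType) := Valuation {
  val_fun :> K -> G;
  val_mul : forall x y, x != 0 -> y != 0 ->
    val_fun (x * y) = val_fun x + val_fun y;
  val_add : forall x y, x != 0 -> y != 0 -> x + y != 0 ->
    Num.min (val_fun x) (val_fun y) <= val_fun (x + y)
}.

Section ValuedField.
Variables (K : fieldType) (G : orderedGroupType) (v : valuation K G).

Definition valuation_ring : {pred K} := [pred x | (x == 0) || (0 <= v x)].
Definition valuation_ideal : {pred K} := [pred x | (x == 0) || (0 < v x)].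

Definition nontrivial_valuation : Prop := exists2 x, x != 0 & v x != 0.

Definition henselian : Prop :=
  forall (f : {poly K}) (a : K),
    f \is a polyOver valuation_ring -> a \in valuation_ring ->
    f.[a] \in valuation_ideal -> f^`().[a] \notin valuation_ideal ->
  exists b : K,
    [/\ b \in valuation_ring, f.[b] = 0 & b - a \in valuation_ideal].

Lemma val1 : v 1 = 0.
Proof.
have := @val_mul _ _ v 1 1 (oner_neq0 K) (oner_neq0 K).
by rewrite mulr1 => /esym/eqP; rewrite -subr_eq0 addrK => /eqP.
Qed.

Lemma og_mulr2n_eq0 (g : G) : g + g = 0 -> g = 0.
Proof.
move=> gg0; apply/eqP; rewrite eq_le; have [g0|g0] := orP (og_total g 0).
  by rewrite g0 /=; have := og_leD2r g _ _ g0; rewrite gg0 add0r.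
by rewrite g0 andbT; have := og_leD2r g _ _ g0; rewrite gg0 add0r.
Qed.

Lemma valN x : x != 0 -> v (- x) = v x.
Proof.
move=> x0; have N1 : (-1 : K) != 0 by rewrite oppr_eq0 oner_neq0.
have vN1 : v (-1) = 0.
  by apply: og_mulr2n_eq0; rewrite -val_mul // mulrNN mulr1 val1.
by rewrite -mulN1r val_mul // vN1 add0r.
Qed.

Lemma valV x : x != 0 -> v x^-1 = - v x.
Proof.
move=> x0; apply/eqP; rewrite eq_sym -subr_eq0 -opprD oppr_eq0.
by rewrite -val_mul ?invr_eq0 // divff // val1.
Qed.

Lemma og_addr_ge0 (g h : G) : 0 <= g -> 0 <= h -> 0 <= g + h.
Proof.
by move=> g0 h0; apply: le_trans h0 _; have := og_leD2r h _ _ g0; rewrite add0r.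
Qed.

Lemma og_addr_gt0 (g h : G) : 0 < g -> 0 <= h -> 0 < g + h.
Proof.
move=> g0 h0; rewrite lt_neqAle og_addr_ge0 ?(ltW g0) // andbT.
apply/negP => /eqP gh; have := og_leD2r g _ _ h0.
by rewrite add0r addrC -gh => /(lt_le_trans g0); rewrite ltxx.
Qed.

Fact valuation_ring_subring : subring_closed valuation_ring.
Proof.
split=> [|x y|x y]; rewrite !inE; first by rewrite val1 lexx orbT.
- have [->|x0] := eqVneq x 0.
    by rewrite sub0r oppr_eq0; have [//|y0 _] := eqVneq y 0; rewrite valN.
  have [->|y0] := eqVneq y 0; first by rewrite subr0 (negPf x0).
  move=> /= vx vy; have [//|xy0] /= := eqVneq (x - y) 0.
  have y'0 : - y != 0 by rewrite oppr_eq0.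
  apply: le_trans (val_add v x0 y'0 xy0).
  by rewrite valN // /Order.min; case: ifP.
- have [->|x0] := eqVneq x 0; first by rewrite mul0r eqxx.
  have [->|y0] := eqVneq y 0; first by rewrite mulr0 eqxx.
  by move=> /= vx vy; rewrite val_mul // og_addr_ge0 ?orbT.
Qed.

HB.instance Definition _ :=
  GRing.isSubringClosed.Build K valuation_ring valuation_ring_subring.

Record valuation_ring_type := ValuationRing {
  vr_val :> K;
  vr_valP : vr_val \in valuation_ring
}.
HB.instance Definition _ := [isSub for vr_val].
HB.instance Definition _ := [Choice of valuation_ring_type by <:].
HB.instance Definition _ :=
  [SubChoice_isSubComNzRing of valuation_ring_type by <:].

Definition maximal_ideal : {pred valuation_ring_type} :=
  [pred x | vr_val x \in valuation_ideal].

Fact maximal_idealP : idealr_closed maximal_ideal.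
Proof.
split; rewrite ?inE /=; first by rewrite eqxx.
  by rewrite (oner_eq0 K) val1 ltxx.
move=> a x y; rewrite !inE -![vr_val _]/(val _) rmorphD rmorphM /=.
case: a x y => [a Oa] [x Ox] [y Oy] /=; rewrite inE in Oa.
have [->|x0] := eqVneq x 0; first by rewrite mulr0 add0r.
have [->|a0] := eqVneq a 0; first by rewrite mul0r add0r.
move: Oa; rewrite (negPf a0) /= => va vx.
have vax : 0 < v (a * x) by rewrite val_mul // addrC og_addr_gt0.
have [->|y0] /= := eqVneq y 0; first by rewrite addr0 vax orbT.
move=> vy; have [//|axy0] /= := eqVneq (a * x + y) 0.
apply: lt_le_trans (val_add v (mulf_neq0 a0 x0) y0 axy0).
by rewrite /Order.min; case: ifP.
Qed.

HB.instance Definition _ :=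
  isIdealr.Build valuation_ring_type maximal_ideal maximal_idealP.

Definition residue_field : Type := {ideal_quot maximal_ideal}.
HB.instance Definition _ := GRing.ComNzRing.on residue_field.
HB.instance Definition _ := EqQuotient.on residue_field.

Definition residue_inv (x : residue_field) : residue_field :=
  if x == 0 then 0 else
  if insub (vr_val (repr x))^-1 is Some y then \pi_residue_field y else 0.

Fact residue_mulVf (x : residue_field) : x != 0 -> residue_inv x * x = 1.
Proof.
move=> x0; rewrite /residue_inv (negPf x0).
move: x0; rewrite -{1 3}[x]reprK; case: (repr x) => a Oa /= x0.
have am : a \notin valuation_ideal.
  apply: contraNN x0 => am.
  by rewrite piE /Quotient.equiv subr0 inE.
have {}am : (a != 0) && ~~ (0 < v a) by rewrite -negb_or.
case/andP: am => a0 va; have va0 : v a = 0.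
  move: (Oa); rewrite inE (negPf a0) /= le_eqVlt (negPf va) orbF.
  by move/eqP.
have OaV : a^-1 \in valuation_ring by rewrite inE valV // va0 oppr0 lexx orbT.
case: insubP => [u _ uE|]; last by rewrite OaV.
rewrite -rmorphM; have -> : u * ValuationRing Oa = 1.
  by apply: val_inj; rewrite rmorphM rmorph1 /= [vr_val u]uE mulVf.
by rewrite rmorph1.
Qed.

Fact residue_inv0 : residue_inv 0 = 0.
Proof. by rewrite /residue_inv eqxx. Qed.

HB.instance Definition _ :=
  GRing.ComNzRing_isField.Build residue_field residue_mulVf residue_inv0.

End ValuedField.

(** * Pseudo-finite fields *)

Definition finite_field (k : fieldType) : Prop :=
  exists s : seq k, forall x, x \in s.

Definition perfect_field (k : fieldType) : Prop :=
  forall p : {poly k}, irreducible_poly p -> separable_poly p.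

Definition algebraic_closure (k Omega : fieldType) (iota : {rmorphism k -> Omega})
  : Prop :=
  GRing.closed_field_axiom Omega /\ forall x : Omega, algebraicOver iota x.

Section Varieties.
Variables (k : fieldType) (n m : nat) (F : 'I_m -> {mpoly k[n]}).

Definition in_ideal (g : {mpoly k[n]}) : Prop :=
  exists c : 'I_m -> {mpoly k[n]}, g = \sum_(i < m) c i * F i.

Definition generates_prime_ideal : Prop :=
  ~ in_ideal 1 /\
  forall g h, in_ideal (g * h) -> in_ideal g \/ in_ideal h.

End Varieties.

(* The affine k-variety F = 0 is absolutely irreducible, i.e., it is integral
   over the algebraic closure of k. *)
Definition absolutely_irreducible (k : fieldType) n m
    (F : 'I_m -> {mpoly k[n]}) : Prop :=
  forall (Omega : fieldType) (iota : {rmorphism k -> Omega}),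
    algebraic_closure iota ->
    generates_prime_ideal (fun i => map_mpoly iota (F i)).

(* A nonempty open affine subset of an absolutely irreducible variety is
   absolutely irreducible, so affine varieties suffice. *)
Definition pseudo_algebraically_closed (k : fieldType) : Prop :=
  forall n m (F : 'I_m -> {mpoly k[n]}),
    absolutely_irreducible F ->
    exists a : 'I_n -> k, forall i, (F i).@[a] = 0.

Section Subextensions.
Variables (k Omega : fieldType) (iota : {rmorphism k -> Omega}).

Definition intermediate_field (E : Omega -> Prop) : Prop :=
  [/\ forall c, E (iota c),
      forall x y, E x -> E y -> E (x - y),
      forall x y, E x -> E y -> E (x * y)
    & forall x, E x -> E x^-1].

Definition has_degree (d : nat) (E : Omega -> Prop) : Prop :=
  exists b : 'I_d -> Omega, (forall i, E (b i)) /\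
    forall x, E x ->
      exists! c : {ffun 'I_d -> k}, x = \sum_(i < d) iota (c i) * b i.

Definition subextension (d : nat) (E : Omega -> Prop) : Prop :=
  intermediate_field E /\ has_degree d E.

End Subextensions.

(* Extensions are counted as subfields of an algebraic closure: counting them
   up to isomorphism would be weaker, as it would also allow, e.g., the absolute
   Galois group to be the product of the Z_p for p > 3 with a nonabelian
   semidirect product of Z_3 by Z_2. *)
Definition unique_extension_each_degree (k : fieldType) : Prop :=
  exists (Omega : fieldType) (iota : {rmorphism k -> Omega}),
    algebraic_closure iota /\
    forall d, (0 < d)%N ->
      exists E : Omega -> Prop, subextension iota d E /\
        forall E' : Omega -> Prop, subextension iota d E' ->
          forall x, E' x <-> E x.

Definition pseudo_finite (k : fieldType) : Prop :=
  [/\ ~ finite_field k, perfect_field k, pseudo_algebraically_closed k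
    & unique_extension_each_degree k].

(* Main.v *)
From Stdlib Require Import Classical_Prop.
Require Import Defs.
From HB Require Import structures.
From mathcomp Require Import all_boot all_order all_algebra.
From mathcomp Require Import ring_quotient mpoly.
From mathcomp Require Import ring.

(** The formula phi(x) says that x = m1 + m2 + e1 + e2, where e1, e2 are 0, 1 or
    -1, and 1 + c m1^2, 1 + c m2^2 are nonzero squares, for some nonzero
    nonsquare c such that 1 + c is not a nonzero square.

    By Hensel's lemma 1 + M consists of squares, M being the maximal ideal. So c
    is not in M, and if m were not in O then 1 + c m^2 would be c times a nonzero
    square; hence phi(K) is contained in O.

    Conversely let k be the residue field. If -1 is not a square in k take
    c = -1; otherwise take c = (1 - n)^2 / 4n with n nonsquare, for which
    1 + c = (1 + n)^2 / 4n. The m in k for which 1 + c m^2 is a square are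
    parametrized by m = 2 r / (1 - c r^2), and every x in k is the sum of two of
    them. If k is finite, this holds because they make up more than half of k; if
    k is pseudo-algebraically closed, because the representations of x with
    first summand m correspond to points of an absolutely irreducible curve
    s^2 = D(r). Lifting to O works by Hensel's lemma unless 1 + c m^2 = 0 in k;
    then c = -1 and m = 1 or -1, and m is replaced by 0 + e. *)

Set Implicit Arguments.
Unset Strict Implicit.
Unset Printing Implicit Defensive.

Import GRing.Theory.
Local Open Scope ring_scope.
Local Open Scope quotient_scope.

(** * Double covers of the affine line *)

Section ClosedField.
Variable F : fieldType.
Hypothesis closedF : GRing.closed_field_axiom F.

Lemma closed_axiom_root (p : {poly F}) : (1 < size p)%N -> exists x, root p x.
Proof.
move=> p_gt1; have p0 : p != 0 by rewrite -size_poly_gt0 (ltn_trans _ p_gt1).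
have lp0 : lead_coef p != 0 by rewrite lead_coef_eq0.
have n_gt0 : (0 < (size p).-1)%N by case: size p_gt1 => [|[]].
(* The axiom solves monic equations [x^n = sum P_i x^i], hence the sign and the division by the
   leading coefficient. *)
have [x xE] := closedF (fun i => - (p`_i / lead_coef p)) n_gt0.
exists x; apply/rootP; rewrite horner_coef.
have -> : size p = (size p).-1.+1 by rewrite prednK // size_poly_gt0.
rewrite big_ord_recr /= -/(lead_coef p) xE mulr_sumr -big_split /= big1 // => i _.
by rewrite mulNr mulrN mulrA mulrCA mulfV // mulr1 subrr.
Qed.

Lemma closed_axiom_sqrt (a : F) : exists x, x ^+ 2 = a.
Proof.
have [|x] := @closed_axiom_root ('X^2 - a%:P); first by rewrite size_XnsubC.
by move/rootP; rewrite !hornerE => /eqP; rewrite subr_eq0 => /eqP; exists x.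
Qed.

(** If [p] were nonconstant, [p + 1] would have a root, and [p] would take the value [-1] there. *)
Lemma closed_axiom_poly0 (p : {poly F}) : (forall x, p.[x] = 0) -> p = 0.
Proof.
move=> p0; have [p_le1|p_gt1] := leqP (size p) 1.
  by rewrite (size1_polyC p_le1) -horner_coef0 p0.
have [|x] := @closed_axiom_root (p + 1).
  by rewrite size_polyDl // size_poly1.
by rewrite /root !hornerE p0 add0r oner_eq0.
Qed.

End ClosedField.

Lemma mup_simple_root (F : fieldType) (D : {poly F}) (x : F) :
  root D x -> ~~ root D^`() x -> mup x D = 1%N.
Proof.
move=> /factor_theorem [E ->]; rewrite derivM derivXsubC /root !hornerE.
rewrite subrr mulr0 add0r => Ex.
by rewrite mupMr // -['X - _]expr1 mup_XsubCX eqxx.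
Qed.

(** The multiplicity of [x] is even in [p^2] and odd in [D q^2] unless these vanish. *)
Lemma double_cover_norm_eq0 (F : fieldType) (D p q : {poly F}) (x : F) :
  root D x -> ~~ root D^`() x -> p ^+ 2 - D * q ^+ 2 = 0 -> p = 0 /\ q = 0.
Proof.
move=> Dx D'x /eqP; rewrite subr_eq0 => /eqP pDq.
have D0 : D != 0 by apply: contraNneq D'x => ->; rewrite linear0 root0.
have [q0|q0] := eqVneq q 0.
  by move: pDq; rewrite q0 expr0n /= mulr0 => /eqP; rewrite expf_eq0 => /eqP.
have p0 : p != 0.
  apply: contra_eqN pDq => /eqP ->.
  by rewrite expr0n eq_sym mulf_eq0 expf_eq0 (negPf D0).
have /(congr1 (fun p => odd (mup x p))) := pDq.
rewrite !expr2 !mupM ?mulf_neq0 // (mup_simple_root Dx D'x).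
by rewrite !oddD !addbb.
Qed.

Definition poly_mpoly0 (k : nzRingType) (p : {poly k}) : {mpoly k[2]} :=
  (map_poly (@mpolyC 2 k) p).['X_ord0].

Definition double_cover (k : nzRingType) (D : {poly k}) : {mpoly k[2]} :=
  'X_ord_max ^+ 2 - poly_mpoly0 D.

Section PolyMpoly.
Variable k : comNzRingType.
Implicit Types (p q D : {poly k}) (g h : {mpoly k[2]}).

Fact poly_mpoly0_comm : commr_rmorph (@mpolyC 2 k) 'X_ord0.
Proof. by move=> x; apply: mulrC. Qed.

Lemma poly_mpoly0E p : poly_mpoly0 p = horner_morph poly_mpoly0_comm p.
Proof. by []. Qed.

Lemma poly_mpoly0D p q :
  poly_mpoly0 (p + q) = poly_mpoly0 p + poly_mpoly0 q.
Proof. by rewrite !poly_mpoly0E rmorphD. Qed.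

Lemma poly_mpoly0M p q :
  poly_mpoly0 (p * q) = poly_mpoly0 p * poly_mpoly0 q.
Proof. by rewrite !poly_mpoly0E rmorphM. Qed.

Lemma poly_mpoly0C (c : k) : poly_mpoly0 c%:P = c%:MP.
Proof. by rewrite /poly_mpoly0 map_polyC hornerC. Qed.

Lemma poly_mpoly0X : poly_mpoly0 ('X : {poly k}) = 'X_ord0.
Proof. by rewrite /poly_mpoly0 map_polyX hornerX. Qed.

Lemma meval_poly_mpoly0 (a : 'I_2 -> k) p : (poly_mpoly0 p).@[a] = p.[a ord0].
Proof.
elim/poly_ind: p => [|p c IHp].
  by rewrite poly_mpoly0E rmorph0 horner0 meval0.
rewrite poly_mpoly0D poly_mpoly0M poly_mpoly0C poly_mpoly0X !hornerE.
by rewrite mevalD mevalM IHp mevalXU mevalC.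
Qed.

Lemma meval_double_cover (a : 'I_2 -> k) D :
  (double_cover D).@[a] = a ord_max ^+ 2 - D.[a ord0].
Proof. by rewrite mevalB meval_poly_mpoly0 !expr2 mevalM mevalXU. Qed.

(** Division by a polynomial monic of degree 2 in ['X_ord_max]. Polynomials with such a remainder
    include constants and variables and are closed under sums and products. *)
Lemma double_cover_reduce D g : exists p q h,
  g = poly_mpoly0 p + 'X_ord_max * poly_mpoly0 q + h * double_cover D.
Proof.
pose red g := exists p q h,
  g = poly_mpoly0 p + 'X_ord_max * poly_mpoly0 q + h * double_cover D.
rewrite -/(red g).
have redC c : red c%:MP.
  by exists c%:P, 0, 0; rewrite poly_mpoly0C (poly_mpoly0C 0); ring.
have redD g1 g2 : red g1 -> red g2 -> red (g1 + g2).
  move=> [p1 [q1 [h1 ->]]] [p2 [q2 [h2 ->]]].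
  by exists (p1 + p2), (q1 + q2), (h1 + h2); rewrite !poly_mpoly0D; ring.
have redM g1 g2 : red g1 -> red g2 -> red (g1 * g2).
  move=> [p1 [q1 [h1 ->]]] [p2 [q2 [h2 ->]]].
  (* The square of ['X_ord_max] is [D] plus [double_cover D]: the first term goes to the remainder,
     the second to the quotient. *)
  exists (p1 * p2 + D * (q1 * q2)), (p1 * q2 + q1 * p2).
  exists (poly_mpoly0 q1 * poly_mpoly0 q2 + h1 * h2 * double_cover D
    + h1 * (poly_mpoly0 p2 + 'X_ord_max * poly_mpoly0 q2)
    + h2 * (poly_mpoly0 p1 + 'X_ord_max * poly_mpoly0 q1)).
  by rewrite !(poly_mpoly0D, poly_mpoly0M) /double_cover; ring.
have redX i : red 'X_i.
  have [->|->] : i = ord0 \/ i = ord_max.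
    by case: i => [[|[|//]] lti]; [left|right]; apply: val_inj.
    by exists 'X, 0, 0; rewrite poly_mpoly0X (poly_mpoly0C 0); ring.
  by exists 0, 1, 0; rewrite (poly_mpoly0C 0) (poly_mpoly0C 1); ring.
rewrite [g]mpolyE; apply: (big_ind red) => // [|m _]; first exact: (redC 0).
rewrite -mul_mpolyC mpolyXE_id; apply: (redM) => //.
apply: (big_ind red) => // [|i _]; first exact: (redC 1).
by elim: (m i) => [|n IHn]; [exact: (redC 1) | rewrite exprS; apply: redM].
Qed.

End PolyMpoly.

Lemma map_double_cover (k F : comNzRingType) (f : {rmorphism k -> F})
    (D : {poly k}) :
  map_mpoly f (double_cover D) = double_cover (map_poly f D).
Proof.
have mapP p : map_mpoly f (poly_mpoly0 p) = poly_mpoly0 (map_poly f p).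
  elim/poly_ind: p => [|p c IHp].
    by rewrite rmorph0 (poly_mpoly0C 0) (poly_mpoly0C 0) rmorph0.
  rewrite poly_mpoly0D poly_mpoly0M rmorphD rmorphM /= IHp.
  rewrite rmorphD rmorphM /= map_polyX map_polyC /= poly_mpoly0D poly_mpoly0M.
  by rewrite !poly_mpoly0C !poly_mpoly0X map_mpolyC map_mpolyX.
by rewrite rmorphB rmorphXn /= mapP map_mpolyX.
Qed.

(* The coordinate ring is free over [F[t]] with basis [1, s], and its norm
   [p^2 - D q^2] vanishes only at [0]. *)
Lemma double_cover_prime (F : fieldType) (D : {poly F}) (x : F) :
    GRing.closed_field_axiom F -> root D x -> ~~ root D^`() x ->
  generates_prime_ideal (fun=> double_cover D : {mpoly F[2]}) (m := 1).
Proof.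
move=> closedF Dx D'x.
have idealE g : in_ideal (fun _ : 'I_1 => double_cover D) g <->
    exists h, g = h * double_cover D.
  split=> [[c ->]|[h ->]]; last by exists (fun=> h); rewrite big_ord1.
  by rewrite big_ord1; exists (c ord0).
pose pt (t s : F) := fun i : 'I_2 => if i == ord0 then t else s.
have eval_red t s p q h : s ^+ 2 = D.[t] ->
    (poly_mpoly0 p + 'X_ord_max * poly_mpoly0 q + h * double_cover D).@[pt t s]
      = p.[t] + s * q.[t].
  move=> st; rewrite mevalD (mevalM _ h) meval_double_cover mevalD mevalM !meval_poly_mpoly0.
  by rewrite mevalXU /pt /= st subrr mulr0 addr0.
split=> [/idealE [h]|g1 g2 /idealE [h]].
  (* The curve has a point above [t = 0], where the whole ideal vanishes. *)
  have [s st] := closed_axiom_sqrt closedF D.[0].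
  move/(congr1 (meval (pt 0 s))); rewrite meval1 mevalM meval_double_cover.
  by rewrite /pt /= st subrr mulr0 => /eqP; rewrite oner_eq0.
have [p1 [q1 [h1 g1E]]] := double_cover_reduce D g1.
have [p2 [q2 [h2 g2E]]] := double_cover_reduce D g2 => gE.
(* Above each [t] lies a point of the curve. There [g1 * g2] vanishes, and the values of [g1] and
   [g2] divide their norms. *)
have: (p1 ^+ 2 - D * q1 ^+ 2) * (p2 ^+ 2 - D * q2 ^+ 2) = 0.
  apply: closed_axiom_poly0 => // t; have [s st] := closed_axiom_sqrt closedF D.[t].
  have g12 s' : s' ^+ 2 = D.[t] ->
      (p1.[t] + s' * q1.[t]) * (p2.[t] + s' * q2.[t]) = 0.
    move=> s't; rewrite -(eval_red t s' p1 q1 h1) // -(eval_red t s' p2 q2 h2) //.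
    rewrite -g1E -g2E -mevalM gE mevalM meval_double_cover /pt /=.
    by rewrite s't subrr mulr0.
  have := congr1 (fun y => y * ((p1.[t] - s * q1.[t]) * (p2.[t] - s * q2.[t])))
    (g12 s st); rewrite mul0r => <-.
  by rewrite !(hornerM, hornerD, hornerN, horner_exp) -st; ring.
move/eqP; rewrite mulf_eq0 => /orP[] /eqP /(double_cover_norm_eq0 Dx D'x) [p0 q0].
  left; apply/idealE; exists h1; move: g1E; rewrite p0 q0 (poly_mpoly0C 0) => ->.
  by ring.
right; apply/idealE; exists h2; move: g2E; rewrite p0 q0 (poly_mpoly0C 0) => ->.
by ring.
Qed.

(** The simple root makes the curve [s^2 = D(t)] absolutely irreducible. *)
Lemma pac_double_cover_point (k : fieldType) (D : {poly k}) :
    pseudo_algebraically_closed k ->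
    (forall (F : fieldType) (f : {rmorphism k -> F}),
      GRing.closed_field_axiom F ->
      exists x, root (map_poly f D) x && ~~ root (map_poly f D)^`() x) ->
  exists t s : k, s ^+ 2 = D.[t].
Proof.
move=> pac simpleD.
have [F f [closedF _]|a] := pac 2 1%N (fun=> double_cover D).
  have [x /andP[Dx D'x]] := simpleD F f closedF.
  have [N1 prime] := double_cover_prime closedF Dx D'x.
  have idealE g : in_ideal (fun _ : 'I_1 => map_mpoly f (double_cover D)) g <->
      in_ideal (fun _ : 'I_1 => double_cover (map_poly f D)) g.
    by rewrite map_double_cover.
  by split=> [/idealE //|g h /idealE /prime [] gh]; [left|right]; apply/idealE.
move/(_ ord0); rewrite meval_double_cover => /eqP; rewrite subr_eq0 => /eqP.
by exists (a ord0), (a ord_max).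
Qed.

(** * Sums of two coordinates of points of a conic *)

Lemma size_le_mul_undup (T U : eqType) (f : T -> U) (s : seq T) d :
    (forall y, count (fun x => f x == y) s <= d)%N ->
  (size s <= d * size (undup (map f s)))%N.
Proof.
move=> fiber; rewrite -(size_map f) -sum1_size -big_undup_iterop_count /=.
rewrite -sum1_size big_distrr /=; apply: leq_sum => y _.
rewrite muln1; apply: leq_trans (fiber y); rewrite count_map.
have iter1 n : iterop n addn 1 0 = n.
  by case: n => // n; elim: n => //= n IHn; rewrite IHn.
by rewrite iter1; apply/eq_leq/eq_count.
Qed.

(** Zero counts as a square here, unlike in [nonzero_square]. *)
Definition nonsquare (k : fieldType) (c : k) : Prop := forall y, y ^+ 2 != c.

Section ConicSum.
Variables (k : fieldType) (c : k).
Hypotheses (two_neq0 : 2%:R != 0 :> k) (c_nonsq : nonsquare c).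

Lemma nonsquare_neq0 : c != 0.
Proof. by have := c_nonsq 0; rewrite expr0n eq_sym. Qed.

Lemma conic_den_neq0 r : 1 - c * r ^+ 2 != 0.
Proof.
have [->|r0] := eqVneq r 0; first by rewrite expr0n mulr0 subr0 oner_neq0.
have := c_nonsq r^-1; apply: contraNneq => /eqP; rewrite subr_eq0 => /eqP cr.
by rewrite -[c](mulfK (expf_neq0 2 r0)) -cr div1r exprVn.
Qed.

(* Projection of the conic [1 + c m^2 = y^2] from the point [(0, -1)]. *)
Definition conic_param (r : k) : k := 2%:R * r / (1 - c * r ^+ 2).

Lemma conic_paramP r : exists y, 1 + c * conic_param r ^+ 2 = y ^+ 2.
Proof.
exists ((1 + c * r ^+ 2) / (1 - c * r ^+ 2)).
by rewrite /conic_param; field; apply: conic_den_neq0.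
Qed.

(** Cross-multiplication gives [2 (r - s) (1 + c r s) = 0]. So for nonzero [r] the fibre through [r]
    consists of [r] and [-1 / (c r)]. *)
Lemma conic_param_eq r s :
  conic_param r = conic_param s -> r = s \/ 1 + c * r * s = 0.
Proof.
move/eqP; rewrite /conic_param eqr_div ?conic_den_neq0 // => /eqP rs.
have : 2%:R * ((r - s) * (1 + c * r * s)) = 0.
  by transitivity (2%:R * r * (1 - c * s ^+ 2) - 2%:R * s * (1 - c * r ^+ 2));
     [ring | rewrite rs subrr].
by move/eqP; rewrite !mulf_eq0 (negPf two_neq0) subr_eq0 /= => /orP[] /eqP; auto.
Qed.

Lemma conic_param_eq0 r : conic_param r = 0 -> r = 0.
Proof.
move=> fr0; have /conic_param_eq [//|] : conic_param r = conic_param 0.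
  by rewrite fr0 /conic_param mulr0 mul0r.
rewrite mulr0 addr0.
by move/eqP; rewrite oner_eq0.
Qed.

Definition conic_sum_property : Prop := forall x : k, exists m1 m2 y1 y2,
  [/\ x = m1 + m2, 1 + c * m1 ^+ 2 = y1 ^+ 2 & 1 + c * m2 ^+ 2 = y2 ^+ 2].

(* [conic_param] is at most two-to-one, and one-to-one over [0], so its image
   contains more than half of [k] and hence meets each of its reflections. *)
Lemma finite_conic_sum : finite_field k -> conic_sum_property.
Proof.
move=> [s0 s0P] x; pose s := undup s0.
have sP y : y \in s by rewrite mem_undup.
have s_uniq : uniq s by apply: undup_uniq.
pose s1 := [seq r <- s | r != 0].
have s1_uniq : uniq s1 by apply: filter_uniq.
pose T1 := undup (map conic_param s1).
have size_T1 : (size s1 <= 2 * size T1)%N.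
  apply: size_le_mul_undup => y; rewrite -size_filter.
  set L := filter _ _; have L_uniq : uniq L by apply: filter_uniq.
  case EL: L => [//|a L']; rewrite -EL.
  have aL : a \in L by rewrite EL mem_head.
  apply: (@uniq_leq_size _ L [:: a; - (c * a)^-1]) => // r.
  move: aL; rewrite !mem_filter !inE => /and3P[/eqP fa a0 _] /and3P[/eqP fr r0 _].
  have := etrans fa (esym fr) => /conic_param_eq [->|]; first by rewrite eqxx.
  move/eqP; rewrite addrC addr_eq0 => /eqP car; apply/orP; right.
  have ca0 : c * a != 0 by rewrite mulf_neq0 ?nonsquare_neq0.
  by rewrite -[r](mulKf ca0) car mulrN1.
pose T := 0 :: T1.
have T1_0 : 0 \notin T1.
  rewrite mem_undup; apply/mapP => -[r]; rewrite mem_filter => /andP[r0 _].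
  by move/esym/conic_param_eq0/eqP; rewrite (negPf r0).
have T_uniq : uniq T by rewrite /= T1_0 undup_uniq.
have size_s : size s = (size s1).+1.
  have /perm_size -> : perm_eq s (0 :: s1).
    apply: uniq_perm => //= [|y]; first by rewrite mem_filter eqxx.
    by rewrite inE mem_filter sP andbT orbN.
  by [].
have TP m : m \in T -> exists r, m = conic_param r.
  rewrite inE => /predU1P[->|].
    by exists 0; rewrite /conic_param mulr0 mul0r.
  by rewrite mem_undup => /mapP[r _ ->]; exists r.
(* Since [|k| = |s1| + 1 <= 2 |T1| + 1 < 2 |T|], the sets [T] and [x - T] must meet. *)
have : has (mem T) [seq x - m | m <- T].
  apply: contraT => disj.
  have : uniq (T ++ [seq x - m | m <- T]).
    by rewrite cat_uniq T_uniq disj map_inj_uniq // => m m' /addrI /oppr_inj.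
  move/uniq_leq_size => /(_ s) leT; have := leT (fun y _ => sP y).
  rewrite size_cat size_map size_s /= addSn ltnS => /leq_trans/(_ size_T1).
  by rewrite mul2n -addnn addnS ltnn.
case/hasP => m1 /mapP[m2 /TP[r2 m2E] ->] /TP[r1 xE].
have [[y1 y1E] [y2 y2E]] := (conic_paramP r1, conic_paramP r2).
exists (conic_param r1), (conic_param r2), y1, y2; split=> //.
by rewrite -xE -m2E subrK.
Qed.

(** At [t] this is [(1 - c t^2)^2 (1 + c (x - m)^2)] with [m = conic_param t]. *)
Definition conic_sum_poly (x : k) : {poly k} :=
  (1 - c *: 'X^2) ^+ 2 + c *: (x *: (1 - c *: 'X^2) - 2%:R *: 'X) ^+ 2.

(** With [d^2 = - f c] the polynomial is a difference of squares [P1 * P2]. A root of [P1] is not a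
    root of [P2], and it is simple in [P1] if [d a] is neither 0 nor 2. *)
Lemma map_conic_sum_poly_simple_root (F : fieldType) (f : {rmorphism k -> F})
    (x : k) :
  GRing.closed_field_axiom F -> x != 0 ->
  exists t, root (map_poly f (conic_sum_poly x)) t
    && ~~ root (map_poly f (conic_sum_poly x))^`() t.
Proof.
move=> closedF x0; pose a := f x.
have a0 : a != 0 by rewrite fmorph_eq0.
have two0 : 2%:R != 0 :> F by rewrite -(rmorph_nat f) fmorph_eq0.
have [d d2 da2] : exists2 d, d ^+ 2 = - f c & d * a != 2%:R.
  have [d d2] := closed_axiom_sqrt closedF (- f c).
  have [da|] := eqVneq (d * a) 2%:R; last by exists d.
  (* If both signs of [d] failed, 4 would be 0. *)
  exists (- d); rewrite ?sqrrN // mulNr da eq_sym -addr_eq0 -natrD.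
  by rewrite (natrM _ 2 2) mulf_neq0.
have d0 : d != 0.
  have : d ^+ 2 != 0 by rewrite d2 oppr_eq0 fmorph_eq0 nonsquare_neq0.
  by rewrite expf_eq0.
have fc : f c = - d ^+ 2 by rewrite d2 opprK.
pose P1 := (1 - d * a) *: (1 + d ^+ 2 *: 'X^2) + (2%:R * d) *: 'X.
pose P2 := (1 + d * a) *: (1 + d ^+ 2 *: 'X^2) - (2%:R * d) *: 'X.
have DE : map_poly f (conic_sum_poly x) = P1 * P2.
  rewrite /conic_sum_poly /P1 /P2 -!mul_polyC.
  rewrite !(rmorphD, rmorphN, rmorphM, rmorphXn, rmorph1) /=.
  rewrite !map_polyC !map_polyX /= -/a fc ?rmorph_nat ?rmorph1.
  by rewrite !(polyCD, polyCN, polyCM, polyC_exp, polyC_natr); ring.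
have [t P1t] : exists t, root P1 t.
  apply: (closed_axiom_root closedF); rewrite ltnNge; apply/negP => sizeP1.
  (* The linear coefficient is [2 d], so [P1] is nonconstant even if [1 - d a = 0]. *)
  have /eqP : P1`_1 = 0 by rewrite nth_default.
  by rewrite !coefE /= !mulr0 !addr0 mulr0 mulr1 add0r mulf_eq0 (negPf two0) (negPf d0).
exists t; move: P1t => /rootP P1t; rewrite DE derivM /root hornerM P1t mul0r eqxx.
rewrite (hornerD (P1^`() * P2)) (hornerM P1^`()) (hornerM P1) P1t mul0r addr0 /=.
have P1tE : (1 - d * a) * (1 + (d * t) ^+ 2) + 2%:R * (d * t) = 0.
  by rewrite -P1t !hornerE /=; ring.
have P2t : P2.[t] = 2%:R * (1 + (d * t) ^+ 2).
  by rewrite -[LHS]addr0 -[X in _ + X]P1t !hornerE /=; ring.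
have P1't : P1^`().[t] = 2%:R * d * ((1 - d * a) * (d * t) + 1).
  by rewrite !(derivE, hornerE) /=; ring.
rewrite P1't P2t !mulf_neq0 //; last first.
  apply/eqP => dt; move: P1tE; rewrite dt mulr0 add0r => /eqP.
  rewrite !mulf_eq0 (negPf two0) (negPf d0) /= => /eqP t0.
  by move: dt => /eqP; rewrite t0 mulr0 expr0n addr0 oner_eq0.
apply/eqP => dt.
(* Up to the factor [-4 d^2], this is the discriminant of [P1]. *)
have : (d * a) * (d * a - 2%:R) = 0.
  have dta : d * t = d * a - 1.
    transitivity ((1 - d * a) * (1 + (d * t) ^+ 2) + 2%:R * (d * t)
      - (d * t) * ((1 - d * a) * (d * t) + 1) - (1 - d * a)); first by ring.
    by rewrite P1tE dt; ring.
  have -> : d * a * (d * a - 2%:R) = - ((1 - d * a) * (d * a - 1) + 1) by ring.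
  by rewrite -dta dt oppr0.
by move/eqP; rewrite !mulf_eq0 (negPf d0) (negPf a0) subr_eq0 (negPf da2).
Qed.

Lemma pac_conic_sum : pseudo_algebraically_closed k -> conic_sum_property.
Proof.
(* For [x = 0] the polynomial is the square of [1 + c t^2], and the curve splits. *)
move=> pac x; have [->|x0] := eqVneq x 0.
  by exists 0, 0, 1, 1; rewrite expr0n mulr0 !addr0 expr1n.
have [t [s sE]] := pac_double_cover_point pac
  (fun F f closedF => map_conic_sum_poly_simple_root f closedF x0).
have [y yE] := conic_paramP t.
exists (conic_param t), (x - conic_param t), y, (s / (1 - c * t ^+ 2)).
split; [by rewrite addrC subrK | exact: yE |].
rewrite expr_div_n sE /conic_param /conic_sum_poly !hornerE /=.
by field; rewrite -mulrA conic_den_neq0.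
Qed.

End ConicSum.

(** * Nonsquares and the choice of c in the residue field *)

Lemma finite_nonsquare (k : fieldType) :
  2%:R != 0 :> k -> finite_field k -> exists n : k, nonsquare n.
Proof.
move=> two0 [s0 s0P]; pose s := undup s0.
have sP y : y \in s by rewrite mem_undup.
(* Leaving out [-1] loses no square, as [1] has the same square and differs from it. Hence there are
   fewer squares than elements. *)
pose sq := [seq y ^+ 2 | y <- rem (-1) s].
have [sqP|/allPn [n _ nP]] := boolP (all (mem sq) s).
  have := uniq_leq_size (undup_uniq s0) (allP sqP).
  by rewrite size_map size_rem // -ltnS prednK ?ltnn // lt0n size_eq0;
    apply: contraTneq (sP 0) => ->.
have remP y : y != -1 -> y ^+ 2 \in sq.
  by move=> yN1; apply: map_f; rewrite mem_rem_uniq ?undup_uniq // !inE yN1 sP.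
exists n => y; apply: contraNneq nP => <- /=.
have [->|/remP //] := eqVneq y (-1); rewrite sqrrN; apply: remP.
by rewrite -addr_eq0 -mulr2n.
Qed.

(* Completing the square: a quadratic extension is generated by a square
   root. *)
Lemma quadratic_subextension_nonsquare (k F : fieldType) (f : {rmorphism k -> F})
    (E : F -> Prop) :
  2%:R != 0 :> k -> subextension f 2 E -> exists n : k, nonsquare n.
Proof.
move=> two0 [[Ek _ EM _] [b [Eb bP]]]; apply: NNPP => no_nonsq.
have sqrtk a : exists y : k, y ^+ 2 = a.
  apply: NNPP => Na; apply: no_nonsq; exists a => y.
  by apply/eqP => ya; apply: Na; exists y.
pose b0 := b ord0; pose b1 := b ord_max.
have span x : E x -> exists a0 a1, x = f a0 * b0 + f a1 * b1.
  by move=> /bP [a [-> _]]; exists (a ord0), (a ord_max); rewrite !big_ord_recl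
    big_ord0 addr0; congr (_ + f (a _) * b _); apply: val_inj.
have free a0 a1 : f a0 * b0 + f a1 * b1 = 0 -> a0 = 0 /\ a1 = 0.
  have [a [_ aP]] := bP 0 (eq_ind _ E (Ek 0) _ (rmorph0 f)).
  have sum2 (a' : {ffun 'I_2 -> k}) :
      \sum_(i < 2) f (a' i) * b i = f (a' ord0) * b0 + f (a' ord_max) * b1.
    rewrite !big_ord_recl big_ord0 addr0; congr (_ + f (a' _) * b _);
    exact: val_inj.
  move=> a01; pose a' : {ffun 'I_2 -> k} := [ffun i => if i == ord0 then a0 else a1].
  have a'E : a = a' by apply: aP; rewrite sum2 !ffunE.
  have aE : a = [ffun=> 0].
    by apply: aP; rewrite sum2 !ffunE rmorph0 !mul0r addr0.
  move: a'E; rewrite aE => /ffunP a'E.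
  by have := a'E ord0; have := a'E ord_max; rewrite !ffunE.
(* If [k] had only squares, [E] would be the image of [k], too small for a basis of two elements. *)
have algk x : E x -> exists a, x = f a.
  move=> Ex; have E1 : E 1 by rewrite -(rmorph1 f).
  have [u0 [u1 uE]] := span _ E1; have [w0 [w1 wE]] := span _ Ex.
  have [z0 [z1 zE]] := span _ (EM _ _ Ex Ex).
  (* The determinant of [1] and [x] in the basis [b]. If it vanishes, [x] is proportional to [1];
     otherwise Cramer's rule writes [x^2] in terms of [x] and [1]. *)
  pose det := u0 * w1 - u1 * w0.
  have [det0|det0] := eqVneq det 0.
    have lin u w : u * w1 - w * u1 = 0 -> u * w0 - w * u0 = 0 -> f u * x = f w.
      move=> uw1 uw0; apply/eqP; rewrite -subr_eq0; apply/eqP.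
      transitivity (f (u * w0 - w * u0) * b0 + f (u * w1 - w * u1) * b1).
        by rewrite -[f w in LHS]mulr1 wE uE !rmorphB !rmorphM; ring.
      by rewrite uw0 uw1 rmorph0 !mul0r addr0.
    have divf u w : u != 0 -> f u * x = f w -> exists a, x = f a.
      move=> u0' xE; exists (w / u); rewrite fmorph_div -xE mulrC mulKf //.
      by rewrite fmorph_eq0.
    have [u00|u00] := eqVneq u0 0; last first.
      by apply: (divf u0 w0) => //; apply: lin; [rewrite mulrC -det0 /det; ring|ring].
    have [u10|u10] := eqVneq u1 0; last first.
      by apply: (divf u1 w1) => //; apply: lin; [ring|rewrite -[RHS]oppr0 -det0 /det; ring].
    by move: uE => /eqP; rewrite u00 u10 rmorph0 !mul0r addr0 oner_eq0.
  pose al := (z1 * u0 - z0 * u1) / det; pose be := (z0 * w1 - z1 * w0) / det.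
  have fdet0 : f det != 0 by rewrite fmorph_eq0.
  have x2 : x ^+ 2 = f al * x + f be.
    have detV y : f det * f (y / det) = f y by rewrite -rmorphM mulrC divfK.
    apply: (mulfI fdet0); rewrite (mulrDr (f det) (f al * x)).
    rewrite (mulrA _ (f al)) /al /be !detV.
    rewrite expr2 zE -[f (z0 * w1 - _)]mulr1 wE uE /det !rmorphB !rmorphM.
    by ring.
  have [y yE] := sqrtk (be + (al / 2%:R) ^+ 2).
  have : (x - f (al / 2%:R)) ^+ 2 = f y ^+ 2.
    rewrite -rmorphXn yE rmorphD /= rmorphXn /= fmorph_div rmorph_nat sqrrB x2.
    by field; rewrite -(rmorph_nat f) fmorph_eq0.
  move/eqP; rewrite eqf_sqr => /orP[] /eqP xy.
    by exists (y + al / 2%:R); rewrite rmorphD -xy subrK.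
  by exists (- y + al / 2%:R); rewrite rmorphD rmorphN -xy subrK.
have [[a0 a0E] [a1 a1E]] := (algk _ (Eb ord0), algk _ (Eb ord_max)).
(* The relation is [a1 b0 - a0 b1 = 0]. *)
have [_ /eqP] : a1 = 0 /\ - a0 = 0.
  by apply: free; rewrite /b0 /b1 a0E a1E rmorphN; ring.
rewrite oppr_eq0 => /eqP a00.
have [/eqP] : (1 : k) = 0 /\ (0 : k) = 0.
  by apply: free; rewrite /b0 a0E a00 rmorph0 mulr0 mul0r addr0.
by rewrite oner_eq0.
Qed.

(** The second condition keeps [1 + c] from being a nonzero square after lifting. The third confines
    the zeros of [1 + c m^2], at which Hensel's lemma does not apply, to [c = -1]. *)
Lemma finite_or_pseudo_finite_conic (k : fieldType) :
    2%:R != 0 :> k -> finite_field k \/ pseudo_finite k ->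
  exists c : k, [/\ nonsquare c, nonsquare (1 + c) \/ c = -1,
    forall m, 1 + c * m ^+ 2 = 0 -> c = -1 & conic_sum_property c].
Proof.
move=> two0 kP.
have csum (c : k) : nonsquare c -> conic_sum_property c.
  case: kP => [fink|[_ _ pac _]] c_nonsq; first exact: finite_conic_sum.
  exact: pac_conic_sum.
have [n n_nonsq] : exists n : k, nonsquare n.
  case: kP => [fink|[_ _ _ [F [f [_ ext]]]]]; first exact: finite_nonsquare.
  have [E [Eext _]] := ext 2 isT.
  exact: quadratic_subextension_nonsquare Eext.
have [[i i2]|N1_nonsq] := classic (exists i : k, i ^+ 2 = -1); last first.
  have N1 : nonsquare (-1 : k) by move=> y; apply/eqP => y2; apply: N1_nonsq; exists y.
  by exists (-1); split; auto.
have n0 := nonsquare_neq0 n_nonsq.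
have four0 : 4%:R != 0 :> k by rewrite (natrM _ 2 2) mulf_neq0.
have nsq a : a != 0 -> nonsquare (a ^+ 2 / (4%:R * n)).
  move=> a0 y; have := n_nonsq (a / (2%:R * y)); apply: contraNneq => yE.
  have y0 : y != 0.
    apply: contra_eqN yE => /eqP ->; rewrite expr0n eq_sym mulf_eq0 expf_eq0 (negPf a0).
    by rewrite invr_eq0 mulf_eq0 (negPf four0) (negPf n0).
  rewrite expr_div_n exprMn yE; apply/eqP; field.
  by rewrite n0 a0 four0.
have n1 : 1 - n != 0.
  by have := n_nonsq 1; apply: contraNneq => /eqP; rewrite expr1n subr_eq0.
have nN1 : 1 + n != 0.
  by have := n_nonsq i; apply: contraNneq => /eqP; rewrite i2 addrC addr_eq0 eq_sym.
have c_nonsq := nsq _ n1; exists ((1 - n) ^+ 2 / (4%:R * n)).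
split; [by [] | left | | exact: csum].
  suff -> : 1 + (1 - n) ^+ 2 / (4%:R * n) = (1 + n) ^+ 2 / (4%:R * n) by exact: nsq.
  by field; rewrite n0 four0.
(* As [-1 = i^2], the value [1 + c m^2] is the denominator [1 - c (i m)^2], so it never vanishes. *)
move=> m cm; have := conic_den_neq0 c_nonsq (i * m).
by rewrite exprMn i2 mulN1r mulrN opprK cm eqxx.
Qed.

(** * Squares in Henselian fields *)

Section HenselianSquares.
Variables (K : fieldType) (G : orderedGroupType) (v : valuation K G).
Implicit Types (x y c m : K) (a b : valuation_ring_type v).

Notation O := (valuation_ring v).
Notation M := (valuation_ideal v).
Notation k := (residue_field v).
Notation res := (\pi_k : valuation_ring_type v -> k).

Lemma residue_eq0 a : (res a == 0) = (vr_val a \in M).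
Proof. by rewrite piE /Quotient.equiv subr0 inE. Qed.

Lemma ideal_ring x : x \in M -> x \in O.
Proof. by rewrite !inE => /orP[->//|/Order.POrderTheory.ltW ->]; rewrite orbT. Qed.

Lemma one_notin_ideal : 1 \notin M.
Proof. by rewrite inE oner_eq0 Defs.val1 Order.POrderTheory.ltxx. Qed.

Lemma ideal_mull x y : x \in O -> y \in M -> x * y \in M.
Proof.
move=> Ox My; have Oy := ideal_ring My.
have := residue_eq0 (ValuationRing Ox * ValuationRing Oy).
rewrite -[vr_val _]/(val _) rmorphM /= => <-.
by rewrite mulf_eq0 !residue_eq0 /= My orbT.
Qed.

Lemma notin_ring_ideal x : x \notin O -> x != 0 /\ x^-1 \in M.
Proof.
rewrite !inE negb_or => /andP[x0 vx]; split=> //; rewrite valV //.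
rewrite Order.POrderTheory.lt_neqAle; apply/orP; right.
have [vx0|vx0] := orP (og_total (v x) 0); last by rewrite vx0 in vx.
have := og_leD2r (- v x) _ _ vx0; rewrite subrr sub0r => ->; rewrite andbT.
rewrite eq_sym oppr_eq0; apply: contraNneq vx => ->.
exact: Order.POrderTheory.lexx.
Qed.

Lemma notin_ideal_inv x : x != 0 -> x \notin M -> x^-1 \in O.
Proof.
move=> x0; apply: contraNT => /notin_ring_ideal [_]; by rewrite invrK.
Qed.

Hypotheses (hens : henselian v) (res_pchar : 2%N \notin [pchar k]).

Lemma residue_two_neq0 : 2%:R != 0 :> k.
Proof. by move: res_pchar; rewrite inE /=. Qed.

(** Hensel's lemma for [X^2 - a] at a lift of [z], where the derivative has the nonzero residue
    [2 z]. *)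
Lemma residue_square_lift a (z : k) :
  z != 0 -> res a = z ^+ 2 -> nonzero_square (vr_val a).
Proof.
move=> z0 az; pose b : valuation_ring_type v := repr z.
have bz : res b = z by apply: reprK.
have [||||y [Oy y2 yb]] := hens (f := 'X^2 - (vr_val a)%:P) (a := vr_val b).
- rewrite rpredB ?polyOverX ?rpredX ?polyOverX // polyOverC; exact: vr_valP.
- exact: vr_valP.
- rewrite !hornerE /= -[X in X \in _]/(val (b ^+ 2 - a)) -residue_eq0.
  by rewrite rmorphB rmorphXn /= bz az subrr.
- rewrite derivB derivXn derivC subr0 !hornerE /=.
  rewrite -[X in X \notin _]/(val (b *+ 2)) -residue_eq0 rmorphMn /= bz.
  by rewrite -mulr_natl mulf_neq0 ?residue_two_neq0.
exists y.
  apply: contraNneq z0 => y0; rewrite -bz residue_eq0.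
  have ON1 : -1 \in O by rewrite rpredN1.
  by have := ideal_mull ON1 yb; rewrite y0 sub0r mulN1r opprK.
by move: y2; rewrite !hornerE /= => /eqP; rewrite subr_eq0 => /eqP.
Qed.

Lemma one_plus_ideal_square x : x \in M -> nonzero_square (1 + x).
Proof.
move=> Mx; have Ox := ideal_ring Mx.
apply: (@residue_square_lift (1 + ValuationRing Ox) 1 (oner_neq0 _)).
have /eqP : res (ValuationRing Ox) == 0 by rewrite residue_eq0.
by move=> x0; rewrite rmorphD rmorph1 /= x0 addr0 expr1n.
Qed.

(** A square root in the ring would reduce to one in [k]; a root [y] outside it would put
    [1 = a y^-2] in the maximal ideal. *)
Lemma residue_nonsquare_lift a :
  nonsquare (res a) -> ~ nonzero_square (vr_val a).
Proof.
move=> a_nonsq [y y0 ay].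
have [Oy|/notin_ring_ideal [_ MyV]] := boolP (y \in O).
  have := a_nonsq (res (ValuationRing Oy)); rewrite -rmorphXn; apply/negP.
  by rewrite negbK; apply/eqP; congr (res _); apply: val_inj; rewrite rmorphXn /= ay.
have : vr_val a * (y^-1 * y^-1) \in M.
  by rewrite !ideal_mull ?(ideal_ring MyV) //; apply: vr_valP.
by rewrite ay -expr2 exprVn divff ?expf_neq0 // (negPf one_notin_ideal).
Qed.

Lemma conic_in_ring c m : c != 0 ->
  ~ nonzero_square c -> ~ nonzero_square (1 + c) ->
  nonzero_square (1 + c * m ^+ 2) -> m \in O.
Proof.
move=> c0 c_nonsq c1_nonsq [y y0 yE].
have Mc : c \notin M by apply/negP => /one_plus_ideal_square.
apply: contraT => /notin_ring_ideal [m0 MmV]; case: c_nonsq.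
(* This is the last factor in [1 + c m^2 = c m^2 (1 + c^-1 m^-2)]; hence [c] is the square of
   [y / (m z)]. *)
have [z z0 zE] : nonzero_square (1 + c^-1 * (m^-1 * m^-1)).
  apply: one_plus_ideal_square; rewrite ideal_mull ?notin_ideal_inv //.
  by rewrite ideal_mull // ideal_ring.
exists (y / (m * z)); first by rewrite mulf_neq0 // invr_eq0 mulf_neq0.
rewrite expr_div_n; have -> : y ^+ 2 = c * (m * z) ^+ 2.
  by rewrite -yE exprMn -zE; field; rewrite c0 m0.
by rewrite mulfK // expf_neq0 // mulf_neq0.
Qed.

(** If [y] is nonzero, [e = 0]. Otherwise [c = -1], and [e] lifts [m = 1] or [-1], so that [a] has
    residue 0. Every such [a] works, which leaves freedom to make the sum exact. *)
Lemma conic_residue_lift (c : valuation_ring_type v) (m y : k) :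
    1 + res c * m ^+ 2 = y ^+ 2 ->
    (1 + res c * m ^+ 2 = 0 -> vr_val c = -1) ->
  exists2 e : valuation_ring_type v, e ^+ 3 = e &
    forall a, res (a + e) = m -> nonzero_square (1 + vr_val c * vr_val a ^+ 2).
Proof.
have lift0 a (z : k) : z != 0 -> 1 + res c * res a ^+ 2 = z ^+ 2 ->
    nonzero_square (1 + vr_val c * vr_val a ^+ 2).
  move=> z0; rewrite -rmorphXn -rmorphM -(rmorph1 res) -rmorphD.
  by move/(residue_square_lift z0).
move=> yE c1; have [y0|y0] := eqVneq y 0; last first.
  by exists 0 => [|a]; [rewrite expr0n | rewrite addr0 => am; apply: (lift0 _ _ y0); rewrite am].
have {}y0 : 1 + res c * m ^+ 2 = 0 by rewrite yE y0 expr0n.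
have {c1} cN1 : c = -1.
  by apply: val_inj; rewrite rmorphN rmorph1; apply: c1.
have m2 : m ^+ 2 = 1.
  move: y0; rewrite cN1 rmorphN rmorph1 mulN1r => /eqP.
  by rewrite subr_eq0 => /eqP.
have [e e3 em] : exists2 e : valuation_ring_type v, e ^+ 3 = e & res e = m.
  move: m2 => /eqP; rewrite sqrf_eq1 => /orP[] /eqP ->.
    by exists 1; rewrite ?expr1n ?rmorph1.
  by exists (-1); rewrite ?rmorphN ?rmorph1 // exprS sqrrN expr1n mulr1.
exists e => // a aem; apply: (lift0 _ _ (oner_neq0 _)).
have -> : res a = 0.
  apply: (addIr (res e)); transitivity m; last by rewrite add0r em.
  by rewrite -aem rmorphD.
by rewrite expr0n mulr0 addr0 expr1n.
Qed.

Hypothesis res_fin : finite_field k \/ pseudo_finite k.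

Lemma valuation_ringP x : x \in O <-> exists c m1 m2 e1 e2,
  [/\ c != 0, ~ nonzero_square c, ~ nonzero_square (1 + c),
      nonzero_square (1 + c * m1 ^+ 2) & nonzero_square (1 + c * m2 ^+ 2)] /\
  [/\ e1 ^+ 3 = e1, e2 ^+ 3 = e2 & x = m1 + m2 + e1 + e2].
Proof.
split=> [Ox|]; last first.
  move=> [c [m1 [m2 [e1 [e2 [[c0 c_nonsq c1_nonsq m1P m2P] [e1P e2P ->]]]]]]].
  have Oe e : e ^+ 3 = e -> e \in O.
    move=> e3; have : e * ((e - 1) * (e + 1)) = 0.
      by transitivity (e ^+ 3 - e); [ring | rewrite e3 subrr].
    move/eqP; rewrite !mulf_eq0 subr_eq0 addr_eq0.
    by case/or3P => /eqP ->; rewrite ?rpred0 ?rpred1 ?rpredN1.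
  have Om m : nonzero_square (1 + c * m ^+ 2) -> m \in O.
    exact: conic_in_ring.
  by rewrite !rpredD // ?(Om _ m1P) ?(Om _ m2P) ?(Oe _ e1P) ?(Oe _ e2P).
have [cb [cb_nonsq cb1 cbN1 csum]] :=
  finite_or_pseudo_finite_conic residue_two_neq0 res_fin.
have [c cE [c_nonsq c1_nonsq]] : exists2 c, res c = cb &
    ~ nonzero_square (1 + vr_val c) /\ (cb = -1 -> vr_val c = -1).
  (* The lift of [-1] must be exactly [-1]: then [1 + c = 0], while another lift could make [1 + c]
     a nonzero square. *)
  have [->|cbNN1] := eqVneq cb (-1).
    exists (-1); first by rewrite rmorphN rmorph1.
    by rewrite -[vr_val _]/(val _) rmorphN rmorph1; split=> // -[y y0];
      rewrite subrr => /esym/eqP; rewrite expf_eq0 (negPf y0).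
  exists (repr cb); first exact: reprK.
  split=> [|/eqP]; last by rewrite (negPf cbNN1).
  case: cb1 => [cb1|/eqP]; last by rewrite (negPf cbNN1).
  have := @residue_nonsquare_lift (1 + repr cb); rewrite rmorphD rmorph1 /= reprK.
  exact.
pose a := ValuationRing Ox.
have [m1 [m2 [y1 [y2 [aE y1E y2E]]]]] := csum (res a).
rewrite -cE in y1E y2E cbN1.
have [e1 e1P m1P] := conic_residue_lift y1E (fun h => c1_nonsq (etrans (esym cE) (cbN1 _ h))).
have [e2 e2P m2P] := conic_residue_lift y2E (fun h => c1_nonsq (etrans (esym cE) (cbN1 _ h))).
(* Any lift serves for [a1]; the equation for [a] then determines [a2], whose residue is right
   because [res a = m1 + m2]. *)
pose a1 : valuation_ring_type v := repr m1 - e1.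
pose a2 := a - e1 - e2 - a1.
have a1E : res (a1 + e1) = m1 by rewrite subrK; apply: reprK.
have a2E : res (a2 + e2) = m2.
  have -> : a2 + e2 = a - (a1 + e1) by rewrite /a2; ring.
  by rewrite rmorphB /= a1E aE addrC addKr.
exists (vr_val c), (vr_val a1), (vr_val a2), (vr_val e1), (vr_val e2).
split; split.
- apply: contraTneq (nonsquare_neq0 cb_nonsq) => c0.
  by rewrite -cE negbK residue_eq0 c0 inE eqxx.
- by apply: residue_nonsquare_lift; rewrite cE.
- exact: c_nonsq.
- exact: m1P.
- exact: m2P.
- by rewrite -[in RHS]e1P -[RHS]/(val _) rmorphXn.
- by rewrite -[in RHS]e2P -[RHS]/(val _) rmorphXn.
have aE' : a = a1 + a2 + e1 + e2 by rewrite /a2; ring.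
by rewrite -[LHS]/(val a) [in LHS]aE' !rmorphD.
Qed.

End HenselianSquares.

(** * The existential formula *)

(* The variables 0, ..., 5 stand for c, m1, m2, e1, e2 and x. *)
Definition fvar (i : nat) : term 6 := TVar (inord i).

Definition cube n (t : term n) : term n := TMul t (TMul t t).

Definition conic_term (m : term 6) : term 6 :=
  TAdd (TOne 6) (TMul (fvar 0) (TMul m m)).

Definition valuation_ring_matrix : formula 6 :=
  FAnd (FAnd (FAnd (FNot (FEq (fvar 0) (TZero 6))) (FNot (FP2 (fvar 0))))
             (FAnd (FNot (FP2 (TAdd (TOne 6) (fvar 0))))
                   (FAnd (FP2 (conic_term (fvar 1))) (FP2 (conic_term (fvar 2))))))
       (FAnd (FAnd (FEq (cube (fvar 3)) (fvar 3)) (FEq (cube (fvar 4)) (fvar 4)))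
             (FEq (fvar 5)
                (TAdd (TAdd (TAdd (fvar 1) (fvar 2)) (fvar 3)) (fvar 4)))).

Definition valuation_ring_formula : formula 1 :=
  FEx (FEx (FEx (FEx (FEx valuation_ring_matrix)))).

Lemma env_cons_inord0 (K : fieldType) n (a : K) (e : 'I_n -> K) :
  env_cons a e (inord 0) = a.
Proof.
have -> : inord 0 = ord0 :> 'I_n.+1 by apply: val_inj; rewrite /= inordK.
by rewrite /env_cons unlift_none.
Qed.

Lemma env_cons_inordS (K : fieldType) n (a : K) (e : 'I_n.+1 -> K) i :
  (i < n.+1)%N -> env_cons a e (inord i.+1) = e (inord i).
Proof.
move=> ltin; have -> : inord i.+1 = lift ord0 (inord i) :> 'I_n.+2.
  by apply: val_inj; rewrite /= /bump leq0n !inordK.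
by rewrite /env_cons liftK.
Qed.

Lemma satisfies_valuation_ring_formula (K : fieldType) (x : K) :
  satisfies valuation_ring_formula x <-> exists c m1 m2 e1 e2,
  [/\ c != 0, ~ nonzero_square c, ~ nonzero_square (1 + c),
      nonzero_square (1 + c * m1 ^+ 2) & nonzero_square (1 + c * m2 ^+ 2)] /\
  [/\ e1 ^+ 3 = e1, e2 ^+ 3 = e2 & x = m1 + m2 + e1 + e2].
Proof.
rewrite /satisfies /=; split.
  move=> [e2 [e1 [m2 [m1 [c]]]]].
  rewrite !(env_cons_inordS, env_cons_inord0) //.
  move=> [[[/eqP c0 cP] [c1 [m1P m2P]]] [[e1P e2P] xE]].
  by exists c, m1, m2, e1, e2.
move=> [c [m1 [m2 [e1 [e2 [[c0 cP c1 m1P m2P] [e1P e2P xE]]]]]]].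
(* The innermost quantifier binds variable 0, so the witnesses come in reverse order. *)
exists e2, e1, m2, m1, c; rewrite !(env_cons_inordS, env_cons_inord0) //.
by do !split=> //; apply/eqP.
Qed.

Theorem theorem1p3 :
  exists phi : formula 1, existential phi /\
    forall (K : fieldType) (G : orderedGroupType) (v : valuation K G),
      nontrivial_valuation v -> henselian v ->
      finite_field (residue_field v) \/ pseudo_finite (residue_field v) ->
      2%N \notin [pchar (residue_field v)] ->
      forall x : K, x \in valuation_ring v <-> satisfies phi x.
Proof.
exists valuation_ring_formula; split=> // K G v _ hens res_fin res_pchar x.
split=> [/(valuation_ringP hens res_pchar res_fin)|].
  by move/satisfies_valuation_ring_formula.
by move/satisfies_valuation_ring_formula/(valuation_ringP hens res_pchar res_fin).
Qed.
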